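(* If $R$ is a finite CC-ring, then $E_{\mathrm{CN}}(K_{|V(\Gamma_R)|})>E_{\mathrm{CN}}(\Gamma_R)$.
   Context: Rings are associative and need not have a unity. A non-commutative ring $R$ is called a CC-ring (commutative centralizer ring) if the centralizer $C_R(x)=\{y\in R: xy=yx\}$ of every non-central element $x$ of $R$ is commutative. For a finite non-commutative ring $R$ with center $Z(R)$, the commuting graph $\Gamma_R$ is the simple graph with vertex set $V(\Gamma_R)=R\setminus Z(R)$ in which two distinct vertices are adjacent if they commute. $K_n$ is the complete graph on $n$ vertices. For a finite simple graph $\Gamma$ with vertices $v_1,\dots,v_n$, the common neighborhood matrix $\mathrm{CN}(\Gamma)$ is the $n\times n$ matrix whose $(i,j)$ entry is $|C(v_i,v_j)|$ if $i\neq j$ and $0$ if $i=j$, where $C(v_i,v_j)$ is the set of common neighbours of $v_i$ and $v_j$. The CN-energy $E_{\mathrm{CN}}(\Gamma)$ is the sum of the absolute values of the eigenvalues of $\mathrm{CN}(\Gamma)$, counted with multiplicity. *)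

(* Defs.v *)
From HB Require Import structures.
From mathcomp Require Import all_boot all_order all_algebra all_field.

Set Implicit Arguments.
Unset Strict Implicit.
Unset Printing Implicit Defensive.

Import Order.TTheory GRing.Theory Num.Theory.

Local Open Scope ring_scope.

(* Every ring structure of MathComp has a unity, so finite associative rings
   that need not have one are given by a biadditive associative product on a
   finite additive abelian group. *)
Record finRng := FinRng {
  rng_sort :> finZmodType;
  rng_mul : rng_sort -> rng_sort -> rng_sort;
  rng_mulA : associative rng_mul;
  rng_mulDl : left_distributive rng_mul +%R;
  rng_mulDr : right_distributive rng_mul +%R }.

Definition rng_commute (R : finRng) (x y : R) : bool :=
  rng_mul x y == rng_mul y x.

Definition rng_center (R : finRng) : {set R} :=
  [set x : R | [forall y : R, rng_commute x y]].

Definition rng_centralizer (R : finRng) (x : R) : {set R} :=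
  [set y : R | rng_commute x y].

Definition noncommutative_rng (R : finRng) : Prop :=
  ~ commutative (@rng_mul R).

Definition CC_ring (R : finRng) : Prop :=
  noncommutative_rng R /\
  forall x : R, x \notin rng_center R ->
    {in rng_centralizer x &, commutative (@rng_mul R)}.

Record finGraph := FinGraph {
  vertex :> finType;
  adj : rel vertex;
  adj_sym : symmetric adj;
  adj_irrefl : irreflexive adj }.

Definition complete_adj (n : nat) : rel 'I_n := fun i j => i != j.

Lemma complete_adj_sym n : symmetric (@complete_adj n).
Proof. by move=> i j; rewrite /complete_adj eq_sym. Qed.

Lemma complete_adj_irrefl n : irreflexive (@complete_adj n).
Proof. by move=> i; rewrite /complete_adj eqxx. Qed.

Definition complete_graph (n : nat) : finGraph :=
  FinGraph (@complete_adj_sym n) (@complete_adj_irrefl n).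

Definition noncentral (R : finRng) : finType :=
  {x : R | x \notin rng_center R}.

Definition commuting_adj (R : finRng) : rel (noncentral R) :=
  fun u v => (u != v) && rng_commute (val u) (val v).

Lemma commuting_adj_sym R : symmetric (@commuting_adj R).
Proof.
by move=> u v; rewrite /commuting_adj /rng_commute eq_sym; congr (_ && _);
  exact: eq_sym.
Qed.

Lemma commuting_adj_irrefl R : irreflexive (@commuting_adj R).
Proof. by move=> u; rewrite /commuting_adj eqxx. Qed.

Definition commuting_graph (R : finRng) : finGraph :=
  FinGraph (@commuting_adj_sym R) (@commuting_adj_irrefl R).

Definition common_neighbors (G : finGraph) (u v : G) : {set G} :=
  [set w : G | adj u w && adj v w].

(* The vertices are listed by enum_val; the entries are put in algC so that
   the characteristic polynomial splits. *)
Definition CN_matrix (G : finGraph) : 'M[algC]_#|G| :=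
  \matrix_(i, j) if i == j then 0
                 else #|common_neighbors (enum_val i) (enum_val j)|%:R.

(* The eigenvalues of A with multiplicity, as the roots of its (monic)
   characteristic polynomial; the order of the list is unspecified. *)
Definition spectrum (n : nat) (A : 'M[algC]_n) : seq algC :=
  sval (closed_field_poly_normal (char_poly A)).

Definition CN_energy (G : finGraph) : algC :=
  \sum_(a <- spectrum (CN_matrix G)) `|a|.

(* Main.v *)
(* In a CC-ring commuting is transitive on non-central elements, so the
   commuting graph is a disjoint union of cliques. The CN-matrix of a disjoint
   union of cliques is diagonalized explicitly: a clique of size c contributes
   its indicator vector, with eigenvalue (c - 1)(c - 2), and the differences
   e_u - e_rep, with eigenvalue -(c - 2), where rep is a chosen representative.
   As the trace is zero, the energy is the sum of 2(c - 2) over the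
   non-representatives. For N vertices there are at most N - 1 of those, and
   every c is less than N when the ring is not commutative; since a, b and
   a + b are distinct vertices when a and b do not commute, N >= 3, and the
   energy is less than 2(N - 1)(N - 2), that of the complete graph. *)
Require Import Defs.
From mathcomp Require Import all_boot all_order all_algebra all_field.
Import Order.TTheory GRing.Theory Num.Theory.
Local Open Scope ring_scope.

(** The rows of [P] are left eigenvectors. Over polynomials, [P] intertwines ['X - A] and
    ['X - diag_mx d]; its nonzero determinant cancels, so both characteristic polynomials agree, and
    their linear factors agree up to order. *)
Lemma spectrum_diagonalized (n : nat) (P A : 'M[algC]_n) (d : 'rV[algC]_n) :
  P \in unitmx -> P *m A = diag_mx d *m P ->
  perm_eq (spectrum A) [seq d 0 i | i <- enum 'I_n].
Proof.
move=> uP PA; apply: prod_XsubC_eq; rewrite big_map big_enum /=.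
have <- : char_poly A = \prod_(z <- spectrum A) ('X - z%:P).
  rewrite /spectrum; case: closed_field_poly_normal => s /= Es.
  by rewrite {1}Es (monicP (char_poly_monic A)) scale1r.
have -> : \prod_i ('X - (d 0 i)%:P) = char_poly (diag_mx d).
  rewrite char_poly_trig ?diag_mx_is_trig //.
  by apply: eq_bigr => i _; rewrite mxE eqxx.
have dP0 : \det (map_mx polyC P) != 0.
  by rewrite det_map_mx polyC_eq0 -unitfE -unitmxE.
apply: (mulfI dP0); rewrite [RHS]mulrC -!det_mulmx /char_poly_mx.
rewrite mulmxBr mulmxBl -!map_mxM PA.
by rewrite scalar_mxC.
Qed.

Lemma trace_diagonalized (n : nat) (P A : 'M[algC]_n) (d : 'rV[algC]_n) :
  P \in unitmx -> P *m A = diag_mx d *m P -> \tr A = \sum_i d 0 i.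
Proof.
move=> uP PA; rewrite -mxtrace_diag -[A](mulKmx uP) PA.
by rewrite mxtrace_mulC mulmxK.
Qed.

Section Clusters.

Variables (n : nat) (r : 'I_n -> 'I_n) (w : 'I_n -> algC).
Hypothesis r_idem : forall i, r (r i) = r i.

(** The fibres of [r] are the cliques, [r i] being the representative of the clique of [i], and [w]
    is read only at representatives. *)
Definition cluster_mx : 'M[algC]_n :=
  \matrix_(i, j) if i == j then 0 else (r i == r j)%:R * w (r i).

Definition cluster_eigenbasis : 'M[algC]_n :=
  \matrix_(i, j) if r i == i then (r j == i)%:R
                 else (j == i)%:R - (j == r i)%:R.

Definition cluster_eigenvalues : 'rV[algC]_n :=
  \row_i if r i == i then w i * #|[set j | (r j == i) && (j != i)]|%:R
         else - w (r i).

Lemma cluster_eigenbasis_unit : cluster_eigenbasis \in unitmx.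
Proof.
rewrite -row_free_unit; apply: inj_row_free => v vP0.
have vPk k : \sum_i v 0 i * cluster_eigenbasis i k = 0.
  by have /rowP/(_ k) := vP0; rewrite !mxE.
(* Only rows [k] and [r k] are nonzero in column [k]. *)
have v_nonrep k : r k != k -> v 0 k = - v 0 (r k).
  move=> rk; have /eqP := vPk k.
  rewrite (bigD1 k) //= (bigD1 (r k)) //= big1 => [|i /andP[ik irk]].
    rewrite !mxE r_idem !eqxx (negbTE rk) [k == _]eq_sym (negbTE rk).
    by rewrite subr0 !mulr1 addr0 addr_eq0 => /eqP.
  rewrite mxE; case: ifP => ri; first by rewrite eq_sym (negbTE irk) mulr0.
  rewrite eq_sym (negbTE ik); case: eqP => [ki|_]; last by rewrite subr0 mulr0.
  by rewrite {1}ki r_idem ki eqxx in rk.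
have v_rep k : r k = k -> v 0 k = 0.
  move=> rk; have /eqP := vPk k.
  rewrite (bigD1 k) //= mxE rk !eqxx mulr1.
  (* By [v_nonrep], each other member of the class contributes [v 0 k] again, so the column sum is
     the class size times [v 0 k]; characteristic zero concludes. *)
  rewrite (eq_bigr (fun i => v 0 k * (r i == k)%:R)) => [|i ik]; last first.
    rewrite mxE rk; have [ri|ri] := eqVneq (r i) i.
      by rewrite ri [k == i]eq_sym (negbTE ik) !mulr0.
    rewrite [k == i]eq_sym (negbTE ik) sub0r (v_nonrep i ri) mulrNN eq_sym.
    by case: eqP => [->|]; rewrite ?mulr0.
  rewrite -mulr_sumr -{1}[v 0 k]mulr1 -mulrDr mulf_eq0 => /orP[/eqP //|].
  by rewrite -natr_sum nat1r pnatr_eq0.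
apply/rowP=> k; rewrite mxE; have [/v_rep //|/v_nonrep ->] := eqVneq (r k) k.
by rewrite v_rep ?oppr0.
Qed.

Lemma cluster_diagonalized :
  cluster_eigenbasis *m cluster_mx
    = diag_mx cluster_eigenvalues *m cluster_eigenbasis.
Proof.
apply/matrixP=> i k; rewrite mul_diag_mx [in LHS]mxE !mxE.
have [ri|ri] := eqVneq (r i) i.
  have [rk|rk] := eqVneq (r k) i; last first.
    rewrite mulr0 big1 // => j _; rewrite !mxE ri eqxx.
    have [_|_] := eqVneq j k; first by rewrite mulr0.
    have [->|] := eqVneq (r j) i; last by rewrite mul0r.
    by rewrite eq_sym (negbTE rk) mul0r mulr0.
  rewrite mulr1.
  transitivity (\sum_(j | (r j == i) && (j != k)) w i).
    rewrite [RHS]big_mkcond; apply: eq_bigr => j _; rewrite !mxE ri eqxx rk.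
    have [->|jk] := eqVneq j k; first by rewrite andbF mulr0.
    by rewrite andbT; case: eqP => [->|]; rewrite ?mul1r ?mul0r.
  (* Removing any one member, [k] or the representative [i], leaves the same number of elements. *)
  have card_class l : r l = i ->
      #|[pred j | r j == i]| = #|[pred j | (r j == i) && (j != l)]|.+1.
    move=> rl; rewrite (cardD1 l) inE rl eqxx add1n; congr _.+1.
    by apply: eq_card => j; rewrite !inE andbC.
  rewrite sumr_const cardsE mulr_natr.
  by have := card_class k rk; rewrite (card_class i ri) => -[->].
rewrite (bigD1 i) //= (bigD1 (r i)) //= big1 => [|j /andP[ji jri]].
  rewrite !mxE r_idem !eqxx (negbTE ri) [i == r i]eq_sym (negbTE ri).
  rewrite [k == i]eq_sym [k == r i]eq_sym subr0 mul1r sub0r mulN1r addr0.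
  have [<-|ik] := eqVneq i k.
    by rewrite (negbTE ri) eqxx !mul1r subr0 mulr1 sub0r.
  have [<-|rik] := eqVneq (r i) k.
    by rewrite r_idem eqxx !mul1r oppr0 sub0r mulrN1 opprK addr0.
  by rewrite subrr subr0 mulr0.
by rewrite !mxE (negbTE ri) (negbTE ji) (negbTE jri) subr0 mul0r.
Qed.

Hypothesis w_ge0 : forall i, 0 <= w i.

Lemma cluster_energy :
  \sum_(a <- spectrum cluster_mx) `|a| = 2 * \sum_(i | r i != i) w (r i).
Proof.
have uP := cluster_eigenbasis_unit; have PA := cluster_diagonalized.
rewrite (perm_big _ (spectrum_diagonalized _ _ _ _ uP PA)) big_map big_enum /=.
have tr0 : \sum_i cluster_eigenvalues 0 i = 0.
  rewrite -(trace_diagonalized _ _ _ _ uP PA) /mxtrace big1 // => i _.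
  by rewrite mxE eqxx.
(* Adding the zero trace reduces the claim to one index at a time: [|d|] is [d] at a representative
   and [d + 2 * w (r i)] elsewhere. *)
rewrite -[RHS]add0r -[X in X + _]tr0 mulr_sumr [X in _ + X]big_mkcond.
rewrite -big_split /=.
apply: eq_bigr => i _; rewrite mxE; have [ri|ri] := eqVneq (r i) i.
  by rewrite addr0 ger0_norm // mulr_ge0.
by rewrite normrN ger0_norm // mulr_natl mulr2n addKr.
Qed.

End Clusters.

Lemma CN_energy_clusters (G : finGraph) (r : G -> G) :
  (forall u, r (r u) = r u) ->
  (forall u v, adj u v = (u != v) && (r u == r v)) ->
  CN_energy G = (2 * \sum_(u | r u != u) (#|[set v | r v == r u]| - 2))%:R.
Proof.
move=> r_idem adjE.
pose r' (i : 'I_#|G|) := enum_rank (r (enum_val i)).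
(* Truncated subtraction gives singleton classes weight 0, which keeps [w] nonnegative; they have no
   off-diagonal entry to affect. *)
pose w (i : 'I_#|G|) : algC := (#|[set v | r v == r (enum_val i)]| - 2)%:R.
have r'_idem i : r' (r' i) = r' i by rewrite /r' enum_rankK r_idem.
have AE : CN_matrix G = cluster_mx _ r' w.
  apply/matrixP=> i j; rewrite !mxE; have [//|ij] := eqVneq i j.
  rewrite /r' (inj_eq enum_rank_inj) /w enum_rankK r_idem.
  have uv : enum_val i != enum_val j by rewrite (inj_eq enum_val_inj).
  move: (enum_val i) (enum_val j) uv => u v uv.
  have [ruv|ruv] := eqVneq (r u) (r v); last first.
    rewrite mul0r; apply/eqP; rewrite pnatr_eq0 cards_eq0; apply/eqP/setP=> x.
    rewrite !inE !adjE; apply: contraNF ruv.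
    by case/andP=> /andP[_ /eqP->] /andP[_ /eqP->].
  rewrite mul1r; congr _%:R.
  rewrite (cardsD1 u [set x | _]) (cardsD1 v (_ :\ u)) !inE ruv !eqxx.
  rewrite [v == u]eq_sym uv addnA (addKn 2).
  apply: eq_card => x; rewrite !inE !adjE ruv ![r v == _]eq_sym.
  by rewrite ![_ == x]eq_sym; do !case: eqP.
rewrite /CN_energy AE cluster_energy // natrM natr_sum; congr (_ * _).
rewrite [RHS](reindex _ (onW_bij _ (enum_val_bij G))) /=.
apply: eq_big => i; rewrite /w /r' ?enum_rankK ?r_idem //.
by rewrite -(inj_eq enum_val_inj) enum_rankK.
Qed.

Lemma CN_energy_complete (n : nat) :
  CN_energy (complete_graph n) = (2 * ((n - 1) * (n - 2)))%:R.
Proof.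
case: n => [|n].
  rewrite (@CN_energy_clusters _ id) //; first by rewrite big1 // => -[].
  by case.
rewrite (@CN_energy_clusters (complete_graph n.+1) (fun=> ord0)) // => [|u v]; last first.
  by rewrite eqxx andbT.
congr (2 * _)%:R; rewrite sum_nat_const; congr (_ * (_ - _))%N.
  rewrite subn1 -[in RHS](card_ord n.+1) -(cardC1 ord0).
  by apply: eq_card => i; rewrite !inE eq_sym.
by rewrite -[RHS]card_ord; apply: eq_card => i; rewrite !inE eqxx.
Qed.

(** Both [x] and [z] lie in the centralizer of the non-central [y], which is commutative. *)
Lemma CC_ring_commute_trans (R : finRng) : CC_ring R ->
  forall x y z : R, y \notin rng_center R ->
  rng_commute x y -> rng_commute y z -> rng_commute x z.
Proof.
move=> [_ CC] x y z yZ xy yz; apply/eqP/(CC y yZ); rewrite !inE //.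
by rewrite /rng_commute eq_sym.
Qed.

Theorem corollary5p5 (R : finRng) (hR : CC_ring R) :
  CN_energy (complete_graph #|commuting_graph R|)
    > CN_energy (commuting_graph R).
Proof.
have comm_refl (x : R) : rng_commute x x by exact: eqxx.
have comm_sym (x y : R) : rng_commute x y = rng_commute y x.
  by rewrite /rng_commute eq_sym.
have [a [b ab]] : exists a b : R, ~~ rng_commute a b.
  case: hR => nc _; have [/existsP[a /existsP[b ab]]|nab] :=
    boolP [exists a : R, exists b : R, ~~ rng_commute a b].
    by exists a, b.
  case: nc => a b; apply/eqP; apply: contraNT nab => ab.
  by apply/existsP; exists a; apply/existsP; exists b.
have notZ (x y : R) : ~~ rng_commute x y -> x \notin rng_center R.
  by apply: contraNN; rewrite inE => /forallP.
(* Since [y] commutes with itself, adding it to [x] changes nothing; this makes [a + b] non-central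
   and distinct from [a] and [b]. *)
have commD (x y : R) : rng_commute (x + y) y = rng_commute x y.
  by rewrite /rng_commute rng_mulDl rng_mulDr (inj_eq (addIr _)).
have aZ := notZ _ _ ab.
have bZ : b \notin rng_center R by apply: (notZ b a); rewrite comm_sym.
have cZ : a + b \notin rng_center R by apply: (notZ _ b); rewrite commD.
pose e (u v : commuting_graph R) := rng_commute (val u) (val v).
have e_trans u v w : e u v -> e v w -> e u w.
  exact: (CC_ring_commute_trans _ hR) (valP v).
have e_sym u v : e u v = e v u by exact: comm_sym.
pose r (u : commuting_graph R) := choose (e u) u.
have er u : e u (r u) by apply: chooseP; exact: comm_refl.
have rE u v : e u v = (r u == r v).
  apply/idP/eqP => [uv|ruv]; last by rewrite (e_trans _ _ _ (er u)) // ruv e_sym.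
  have uvE : e u =1 e v.
    by move=> x; apply/idP/idP; apply: e_trans => //; rewrite e_sym.
  rewrite /r (eq_choose uvE); apply: choose_id; last exact: comm_refl.
  by rewrite -uvE; apply: comm_refl.
have r_idem u : r (r u) = r u by apply/esym/eqP; rewrite -rE.
rewrite (@CN_energy_clusters (commuting_graph R) r) // => [|u v]; last first.
  by rewrite -rE.
rewrite CN_energy_complete ltr_nat ltn_pmul2l //.
set N := #|commuting_graph R|.
have N3 : (2 < N)%N.
  pose s := [:: Sub a aZ; Sub b bZ; Sub (a + b) cZ] : seq (commuting_graph R).
  suff us : uniq s by rewrite -[3%N](card_uniqP us) max_card.
  have a_ne_b : a != b by apply: contraNneq ab => ->.
  have a_ne_c : a != a + b.
    by apply: contraNneq ab => aab; rewrite comm_sym -commD addrC -aab.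
  have b_ne_c : b != a + b.
    by apply: contraNneq ab => bab; rewrite -commD -bab.
  by rewrite /= !inE -!val_eqE /= negb_or a_ne_b a_ne_c b_ne_c.
(* A class containing every vertex would make [a] and [b] commute through [u]. *)
have class_lt u : (#|[set v | r v == r u]| < N)%N.
  rewrite /N -[ltnRHS]cardsT; apply: proper_card; rewrite properEneq subsetT andbT.
  apply/eqP=> uT; have cu v : e v u.
    by have := in_setT v; rewrite -uT inE -rE.
  case/negP: ab.
  by apply: (e_trans (Sub a aZ) u (Sub b bZ)); rewrite // e_sym.
have bound u : r u != u -> (#|[set v | r v == r u]| - 2 <= N - 3)%N.
  move=> _; rewrite -[3%N]/(1 + 2)%N subnDA leq_sub2r // subn1 -ltnS.
  by rewrite prednK ?class_lt // (ltn_trans _ N3).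
apply: leq_ltn_trans (leq_sum _ bound) _; rewrite sum_nat_const.
have nonrep : (#|[pred u | r u != u]| <= N - 1)%N.
  pose v : commuting_graph R := Sub a aZ.
  rewrite /N subn1 -(cardC1 (r v)).
  apply: subset_leq_card; apply/subsetP=> u; rewrite !inE.
  by apply: contraNneq => ->; rewrite r_idem.
apply: leq_ltn_trans (leq_mul nonrep (leqnn _)) _.
(* With [N >= 3] no subtraction truncates, so [N - 3 < N - 2] and the factor [N - 1] is positive. *)
case: N N3 {class_lt bound nonrep} => [|[|[|N]]] // _.
by rewrite !subSS !subn0 ltn_pmul2l.
Qed.
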